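(* Let $f,g$ be arithmetical functions whose Dirichlet series $F(s)=\sum_{k\ge1}f(k)k^{-s}$ and $G(s)=\sum_{k\ge1}g(k)k^{-s}$ converge absolutely for $\Re(s)>\sigma_1$ and $\Re(s)>\sigma_2$ respectively, and suppose $U_{f,g}(s)=\sum_{k\ge1}u_{f,g}(k)k^{-s}$ converges absolutely for $\Re(s)>\alpha$. Then $G_L(s):=\sum_{k\ge1}g(k)L(k)k^{-s}$ converges absolutely for $\Re(s)>\sigma_2+1$, and for $\Re(s)>\max\{\alpha,\sigma_1,\sigma_2+1\}$, $$U_{f,g}(s)=-F'(s)G(s-1)+F(s)G_L(s).$$
   Context: For positive integers $k,j$, $s_k(j):=\sum_{d\mid\gcd(k,j)}f(d)g(k/d)$ (Anderson–Apostol sum), and $u_{f,g}(k):=\sum_{j=1}^{k}s_k(j)\log j$. $L(k):=\sum_{m=1}^{k}\log m$. $F'$ denotes the derivative of $F$ with respect to $s$. *)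

(* Defs.v *)
From Stdlib Require Export Reals Arith.
From Coquelicot Require Export Coquelicot.

Open Scope C_scope.

Definition Cexp (z : C) : C :=
  (exp (Re z) * cos (Im z), exp (Re z) * sin (Im z))%R.

(** [n ^ z] for a positive integer [n], with the real logarithm of [n]. *)
Definition nat_cpow (n : nat) (z : C) : C := Cexp (z * RtoC (ln (INR n))).

(** Like [Series], this is only meaningful for a convergent series: see
    [CSeries_correct]. *)
Definition CSeries (a : nat -> C) : C :=
  (Series (fun n => Re (a n)), Series (fun n => Im (a n))).

Lemma CSeries_correct (a : nat -> C) (l : C) :
  @is_series C_AbsRing C_NormedModule a l -> CSeries a = l.
Proof.
  intros H.
  assert (E : forall n, sum_n a n
     = (sum_n (fun k => Re (a k)) n, sum_n (fun k => Im (a k)) n)).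
  { induction n as [|n IH].
    - rewrite !sum_O. destruct (a O); reflexivity.
    - rewrite !sum_Sn, IH. reflexivity. }
  destruct l as [x y]; unfold CSeries; f_equal; apply is_series_unique.
  - intros P [e He].
    destruct (H (fun z => P (fst z))) as [N HN].
    { exists e. intros z [Hz _]. now apply He. }
    exists N. intros n Hn. specialize (HN n Hn). now rewrite E in HN.
  - intros P [e He].
    destruct (H (fun z => P (snd z))) as [N HN].
    { exists e. intros z [_ Hz]. now apply He. }
    exists N. intros n Hn. specialize (HN n Hn). now rewrite E in HN.
Qed.

(** An arithmetical function is a map [nat -> C] whose value at [0] is never
    used: the [n]-th term of the series is the one of index [k = S n]. *)
Definition dirichlet_term (a : nat -> C) (s : C) (n : nat) : C :=
  a (S n) * nat_cpow (S n) (- s).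

Definition dirichlet (a : nat -> C) (s : C) : C :=
  CSeries (dirichlet_term a s).

Definition dirichlet_abs_cv (a : nat -> C) (s : C) : Prop :=
  ex_series (fun n => Cmod (dirichlet_term a s n)).

(** Anderson-Apostol sum [s_k(j)]. *)
Definition anderson_apostol (f g : nat -> C) (k j : nat) : C :=
  sum_n_m (fun d =>
    if Nat.eqb (Nat.modulo (Nat.gcd k j) d) 0
    then f d * g (Nat.div k d) else RtoC 0) 1 (Nat.gcd k j).

Definition u_sum (f g : nat -> C) (k : nat) : C :=
  sum_n_m (fun j => anderson_apostol f g k j * RtoC (ln (INR j))) 1 k.

Definition log_sum (k : nat) : R := sum_n_m (fun m => ln (INR m)) 1 k.

(* Main.v *)
Require Import Defs.
From Stdlib Require Import Lia Lra.

(** Writing [j = d m] in the definition of [u_sum] and using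
    [ln (d m) = ln d + ln m] gives, with [*] the Dirichlet convolution,
    [u_sum f g = (f ln) * (g id) + f * (g L)]. The Dirichlet series of a
    convolution is the product of the series (by Tannery's theorem), that of
    [f ln] is [- F'] (termwise differentiation is controlled by
    [|e^z - 1 - z| <= |z|^2 e^|z|]), and that of [g id] at [s] is [G (s - 1)]. *)

(** * Sums over divisors *)

Lemma eqb_mod_gcd (k j d : nat) :
  Nat.eqb (Nat.gcd k j mod d) 0 = andb (Nat.eqb (k mod d) 0) (Nat.eqb (j mod d) 0).
Proof.
  apply Bool.eq_iff_eq_true.
  rewrite Bool.andb_true_iff, !Nat.eqb_eq, !Nat.Lcm0.mod_divide.
  split.
  - intro Hd. split; (eapply Nat.divide_trans; [exact Hd|]).
    + apply Nat.gcd_divide_l.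
    + apply Nat.gcd_divide_r.
  - intros [Hk Hj]. now apply Nat.gcd_greatest.
Qed.

Section SumDivisors.

Context {G : AbelianMonoid}.

Lemma sum_n_m_truncate (u : nat -> G) (n m N : nat) :
  (n <= S m)%nat -> (m <= N)%nat ->
  (forall k, (m < k <= N)%nat -> u k = zero) ->
  sum_n_m u n N = sum_n_m u n m.
Proof.
  intros Hnm HmN Hu.
  rewrite (sum_n_m_Chasles u n m N), (sum_n_m_ext_loc u (fun _ => zero) (S m) N)
    by (assumption || (intros k Hk; apply Hu; lia)).
  now rewrite sum_n_m_const_zero, plus_zero_r.
Qed.

Lemma sum_n_m_switch (u : nat -> nat -> G) (a b c d : nat) :
  sum_n_m (fun i => sum_n_m (u i) c d) a b
  = sum_n_m (fun j => sum_n_m (fun i => u i j) a b) c d.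
Proof.
  induction b as [|b IH].
  - destruct a as [|a].
    + rewrite sum_n_n. apply sum_n_m_ext; intro j. now rewrite sum_n_n.
    + rewrite sum_n_m_zero, <- (sum_n_m_const_zero c d) by lia.
      apply sum_n_m_ext; intro j. now rewrite sum_n_m_zero by lia.
  - destruct (Nat.le_gt_cases a (S b)) as [Hab|Hab].
    + rewrite sum_n_Sm, IH, <- sum_n_m_plus by exact Hab.
      apply sum_n_m_ext; intro j. now rewrite sum_n_Sm by exact Hab.
    + rewrite sum_n_m_zero, <- (sum_n_m_const_zero c d) by exact Hab.
      apply sum_n_m_ext; intro j. now rewrite sum_n_m_zero by exact Hab.
Qed.

Lemma sum_n_m_multiples (h : nat -> G) (d N : nat) :
  (1 <= d)%nat ->
  sum_n_m (fun n => if Nat.eqb (n mod d) 0 then h n else zero) 1 N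
  = sum_n_m (fun m => h (d * m)%nat) 1 (N / d).
Proof.
  intro Hd. induction N as [|N IH].
  - now rewrite Nat.Div0.div_0_l, !sum_n_m_zero by lia.
  - rewrite sum_n_Sm, IH by lia.
    pose proof (Nat.div_mod_eq N d). pose proof (Nat.div_mod_eq (S N) d).
    pose proof (Nat.mod_upper_bound N d). pose proof (Nat.mod_upper_bound (S N) d).
    destruct (Nat.eqb_spec (S N mod d) 0) as [Hdvd|Hdvd].
    + assert (Hq : (S N / d = S (N / d))%nat) by nia.
      rewrite Hq, sum_n_Sm, <- Hq by lia.
      now replace (d * (S N / d))%nat with (S N) by lia.
    + assert (Hq : (S N / d = N / d)%nat) by nia.
      now rewrite Hq, plus_zero_r.
Qed.

Definition sum_divisors (h : nat -> G) (n : nat) : G :=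
  sum_n_m (fun d => if Nat.eqb (n mod d) 0 then h d else zero) 1 n.

Lemma sum_divisors_ext (h h' : nat -> G) (n : nat) :
  (forall d, (1 <= d)%nat -> n = (d * (n / d))%nat -> h d = h' d) ->
  sum_divisors h n = sum_divisors h' n.
Proof.
  intro Hh. apply sum_n_m_ext_loc; intros d Hd.
  destruct (Nat.eqb_spec (n mod d) 0) as [Hdvd|]; [|reflexivity].
  apply Hh; [lia|]. pose proof (Nat.div_mod_eq n d). lia.
Qed.

Lemma sum_divisors_plus (h h' : nat -> G) (n : nat) :
  sum_divisors (fun d => plus (h d) (h' d)) n
  = plus (sum_divisors h n) (sum_divisors h' n).
Proof.
  unfold sum_divisors. rewrite <- sum_n_m_plus. apply sum_n_m_ext; intro d.
  destruct (Nat.eqb (n mod d) 0); [reflexivity|]. now rewrite plus_zero_l.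
Qed.

Lemma sum_divisors_extend (h : nat -> G) (n N : nat) : (1 <= n <= N)%nat ->
  sum_divisors h n
  = sum_n_m (fun d => if Nat.eqb (n mod d) 0 then h d else zero) 1 N.
Proof.
  intro Hn. symmetry. apply sum_n_m_truncate; [lia|lia|].
  intros d Hd. rewrite Nat.mod_small by lia. now destruct n; [lia|].
Qed.

Lemma sum_n_m_sum_divisors (h : nat -> nat -> G) (N : nat) :
  sum_n_m (fun n => sum_divisors (fun d => h d n) n) 1 N
  = sum_n_m (fun d => sum_n_m (fun m => h d (d * m)%nat) 1 (N / d)) 1 N.
Proof.
  rewrite (sum_n_m_ext_loc _ (fun n => sum_n_m
    (fun d => if Nat.eqb (n mod d) 0 then h d n else zero) 1 N))
    by (intros n Hn; now apply sum_divisors_extend).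
  rewrite sum_n_m_switch. apply sum_n_m_ext_loc; intros d Hd.
  now apply sum_n_m_multiples.
Qed.

Lemma sum_n_m_sum_divisors_gcd (h : nat -> nat -> G) (k : nat) :
  sum_n_m (fun j => sum_divisors (fun d => h d j) (Nat.gcd k j)) 1 k
  = sum_divisors (fun d => sum_n_m (fun m => h d (d * m)%nat) 1 (k / d)) k.
Proof.
  transitivity (sum_n_m (fun j => sum_divisors
    (fun d => if Nat.eqb (k mod d) 0 then h d j else zero) j) 1 k).
  - apply sum_n_m_ext_loc; intros j Hj.
    assert (Hgcd : (1 <= Nat.gcd k j <= j)%nat).
    { split.
      - pose proof (Nat.gcd_eq_0_r k j). lia.
      - apply Nat.divide_pos_le; [lia|apply Nat.gcd_divide_r]. }
    rewrite (sum_divisors_extend _ _ j Hgcd).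
    apply sum_n_m_ext; intro d. rewrite eqb_mod_gcd.
    now destruct (Nat.eqb (k mod d) 0), (Nat.eqb (j mod d) 0).
  - rewrite sum_n_m_sum_divisors. apply sum_n_m_ext; intro d.
    destruct (Nat.eqb (k mod d) 0); [reflexivity|]. apply sum_n_m_const_zero.
Qed.

End SumDivisors.

Lemma sum_divisors_mult_r {K : Ring} (c : K) (h : nat -> K) (n : nat) :
  sum_divisors (fun d => mult (h d) c) n = mult (sum_divisors h n) c.
Proof.
  unfold sum_divisors. rewrite <- sum_n_m_mult_r. apply sum_n_m_ext; intro d.
  destruct (Nat.eqb (n mod d) 0); [reflexivity|]. now rewrite mult_zero_l.
Qed.

Definition dirichlet_conv {K : Ring} {V : ModuleSpace K} (a : nat -> K) (b : nat -> V)
  (n : nat) : V :=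
  sum_divisors (fun d => scal (a d) (b (n / d)%nat)) n.

Lemma sum_n_m_dirichlet_conv {K : Ring} {V : ModuleSpace K} (a : nat -> K) (b : nat -> V)
  (N : nat) :
  sum_n_m (dirichlet_conv a b) 1 N
  = sum_n_m (fun d => scal (a d) (sum_n_m b 1 (N / d))) 1 N.
Proof.
  unfold dirichlet_conv.
  rewrite (sum_n_m_sum_divisors (fun d n => scal (a d) (b (n / d)%nat))).
  apply sum_n_m_ext_loc; intros d Hd. rewrite <- sum_n_m_scal_l.
  apply sum_n_m_ext; intro m. now rewrite Nat.mul_comm, Nat.div_mul by lia.
Qed.

(** * Series *)

Lemma norm_is_series_le {K : AbsRing} {V : NormedModule K} (u : nat -> V) (l : V)
  (M : nat -> R) (B : R) :
  is_series u l -> (forall n, (norm (u n) <= M n)%R) -> is_series M B ->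
  (norm l <= B)%R.
Proof.
  intros Hu HuM HM.
  apply (filterlim_le (F := eventually) (fun n => norm (sum_n u n)) (sum_n M)
    (norm l) B).
  - exists O; intros n _. eapply Rle_trans; [apply norm_sum_n_m|].
    now apply sum_n_m_le.
  - eapply filterlim_comp; [exact Hu|apply filterlim_norm].
  - exact HM.
Qed.

Lemma plus_minus_cancel {G : AbelianGroup} (x y : G) : plus (minus x y) y = x.
Proof. unfold minus. now rewrite <- plus_assoc, plus_opp_l, plus_zero_r. Qed.

Lemma is_series_tail {K : AbsRing} {V : NormedModule K} (u : nat -> V) (l : V) (N : nat) :
  is_series u l -> is_series (fun n => u (S N + n)%nat) (minus l (sum_n u N)).
Proof.
  intro Hu. apply is_series_incr_n; [lia|].
  replace (plus _ _) with l; [exact Hu|].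
  symmetry. exact (plus_minus_cancel l (sum_n u N)).
Qed.

Lemma norm_is_series_tail_le {K : AbsRing} {V : NormedModule K} (u : nat -> V) (l : V)
  (M : nat -> R) (B : R) (N : nat) :
  is_series u l -> (forall n, (norm (u n) <= M n)%R) -> is_series M B ->
  (norm (minus (sum_n u N) l) <= B - sum_n M N)%R.
Proof.
  intros Hu HuM HM.
  rewrite <- norm_opp, opp_minus.
  apply (norm_is_series_le (fun n => u (S N + n)%nat) _ (fun n => M (S N + n)%nat)).
  - now apply is_series_tail.
  - intro n. apply HuM.
  - exact (is_series_tail M B N HM).
Qed.

Lemma filterlim_sum_n {T : Type} {F : (T -> Prop) -> Prop} {FF : Filter F}
  {K : AbsRing} {V : NormedModule K} (u : T -> nat -> V) (v : nat -> V) (N : nat) :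
  (forall n, filterlim (fun x => u x n) F (locally (v n))) ->
  filterlim (fun x => sum_n (u x) N) F (locally (sum_n v N)).
Proof.
  intro Huv. induction N as [|N IH].
  - rewrite sum_O. eapply filterlim_ext; [|apply Huv].
    intro x. now rewrite sum_O.
  - rewrite sum_Sn. eapply filterlim_ext; [intro x; symmetry; apply sum_Sn|].
    eapply filterlim_comp_2; [exact IH|apply Huv|apply filterlim_plus].
Qed.

(* Tannery's theorem: the partial sums converge uniformly in [x] by domination, so
   the limits in [x] and in the number of terms can be exchanged. *)
Lemma filterlim_is_series_dominated {T : Type} {F : (T -> Prop) -> Prop} {FF : Filter F}
  {K : AbsRing} {V : NormedModule K} (u : T -> nat -> V) (U : T -> V)
  (v : nat -> V) (l : V) (M : nat -> R) :
  (forall x, is_series (u x) (U x)) -> is_series v l ->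
  (forall n, filterlim (fun x => u x n) F (locally (v n))) ->
  (forall x n, (norm (u x n) <= M n)%R) -> ex_series M ->
  filterlim U F (locally l).
Proof.
  intros HU Hv Huv HuM [B HM].
  apply (filterlim_switch_1 eventually _ F _ (fun N x => sum_n (u x) N) U (sum_n v) l);
    [| |exact Hv].
  - apply (filterlim_locally (U := fct_UniformSpace T V)). intro eps.
    destruct (proj1 (filterlim_locally _ _) HM eps) as [N HN].
    exists N; intros n Hn x. apply norm_compat1.
    eapply Rle_lt_trans; [exact (norm_is_series_tail_le _ _ _ _ n (HU x) (HuM x) HM)|].
    eapply Rle_lt_trans; [apply Rle_abs|]. rewrite Rabs_minus_sym. exact (HN n Hn).
  - intro N. now apply filterlim_sum_n.
Qed.

Lemma is_series_finite_support {K : AbsRing} {V : NormedModule K} (u : nat -> V) (N : nat) :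
  (forall n, (N < n)%nat -> u n = zero) -> is_series u (sum_n u N).
Proof.
  intro Hu. apply (filterlim_ext_loc (fun _ => sum_n u N)).
  - exists N; intros n Hn. symmetry.
    apply sum_n_m_truncate; [lia|exact Hn|]. intros k Hk. apply Hu, Hk.
  - apply filterlim_const.
Qed.

Lemma filterlim_div_eventually (d : nat) : (1 <= d)%nat ->
  filterlim (fun n => n / d)%nat eventually eventually.
Proof.
  intros Hd P [N HN]. exists (d * N)%nat; intros n Hn.
  apply HN, Nat.div_le_lower_bound; [lia|exact Hn].
Qed.

Lemma is_series_scal_const {K : AbsRing} {V : NormedModule K} (a : nat -> K) (A : K) (x : V) :
  is_series (V := AbsRing_NormedModule K) a A ->
  is_series (fun n => scal (a n) x) (scal A x).
Proof.
  intro Ha.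
  apply (filterlim_ext (fun n => scal (sum_n (G := AbsRing_NormedModule K) a n) x)).
  - intro n. induction n as [|n IH]; [now rewrite !sum_O|].
    rewrite !sum_Sn, <- IH. exact (scal_distr_r _ _ x).
  - exact (filterlim_comp _ _ _ _ _ _ _ _ Ha (filterlim_scal_l A x)).
Qed.

(* The sum up to [N] is [sum_d a d * b_sum (N / d)] with [b_sum] the partial sums of
   [b], and each term tends to [a d * B] as [N] goes to infinity. *)
Lemma is_series_dirichlet_conv {K : AbsRing} {V : NormedModule K}
  (a : nat -> K) (b : nat -> V) (A : K) (B : V) :
  is_series (V := AbsRing_NormedModule K) (fun n => a (S n)) A ->
  ex_series (fun n => abs (a (S n))) ->
  is_series (fun n => b (S n)) B ->
  is_series (fun n => dirichlet_conv a b (S n)) (scal A B).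
Proof.
  intros HA HAabs HB. set (b_sum := fun n => sum_n_m b 1 n).
  assert (Hb_sum : filterlim b_sum eventually (locally B)).
  { intros P HP. destruct (HB P HP) as [N HN].
    exists (S N); intros [|n] Hn; [lia|]. unfold b_sum. rewrite <- sum_n_m_S.
    apply HN; lia. }
  destruct (filterlim_bounded b_sum (ex_intro _ B Hb_sum)) as [bound Hbound].
  apply (filterlim_is_series_dominated
    (fun N n => scal (a (S n)) (b_sum (S N / S n)%nat)) _
    (fun n => scal (a (S n)) B) _ (fun n => abs (a (S n)) * bound)%R).
  - intro N. replace (sum_n _ N)
      with (sum_n (fun n => scal (a (S n)) (b_sum (S N / S n)%nat)) N).
    + apply is_series_finite_support. intros n Hn. unfold b_sum.
      rewrite Nat.div_small, sum_n_m_zero by lia. exact (scal_zero_r _).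
    + unfold sum_n. rewrite (sum_n_m_S (fun d => scal (a d) (b_sum (S N / d)%nat))).
      rewrite sum_n_m_S. symmetry. exact (sum_n_m_dirichlet_conv a b (S N)).
  - now apply is_series_scal_const.
  - intro n. eapply filterlim_comp; [|apply filterlim_scal_r].
    eapply filterlim_comp; [|exact Hb_sum]. intros P HP.
    destruct (filterlim_div_eventually (S n) ltac:(lia) P HP) as [N HN].
    exists N; intros m Hm. apply HN; lia.
  - intros N n. eapply Rle_trans; [apply norm_scal|].
    apply Rmult_le_compat_l; [apply abs_ge_0|apply Hbound].
  - now apply ex_series_scal_r.
Qed.

(* The uniform structure of [C] is that of [R * R], not the one given by [Cmod]. *)
Lemma is_series_AbsRing_C (a : nat -> C) (l : C) :
  is_series (V := C_NormedModule) a l ->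
  is_series (V := AbsRing_NormedModule C_AbsRing) a l.
Proof. intros Ha P HP. apply Ha, locally_C, HP. Qed.

Lemma CSeries_abs_correct (a : nat -> C) :
  ex_series (fun n => Cmod (a n)) ->
  is_series (V := C_NormedModule) a (CSeries a).
Proof.
  intro Ha.
  destruct (ex_series_le (V := C_CompleteNormedModule) a (fun n => Cmod (a n))) as [l Hl].
  - intro n. apply Rle_refl.
  - exact Ha.
  - now rewrite (CSeries_correct a l Hl).
Qed.

Lemma RtoC_sum_n_m (u : nat -> R) (n m : nat) :
  RtoC (sum_n_m u n m) = sum_n_m (fun k => RtoC (u k)) n m.
Proof.
  destruct (Nat.le_gt_cases n m) as [Hnm|Hnm].
  - induction Hnm as [|m Hnm IH]; [now rewrite !sum_n_n|].
    rewrite !sum_n_Sm, <- IH by lia. apply RtoC_plus.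
  - now rewrite !sum_n_m_zero by exact Hnm.
Qed.

(** * Derivatives and the complex exponential *)

Lemma is_derive_of_quadratic_remainder {K : AbsRing} {V : NormedModule K} (f : K -> V)
  (x : K) (l : V) (d M : R) : (0 < d)%R ->
  (forall y, (abs (minus y x) <= d)%R ->
    (norm (minus (minus (f y) (f x)) (scal (minus y x) l)) <= abs (minus y x) ^ 2 * M)%R) ->
  is_derive f x l.
Proof.
  intros Hd Hf. split; [apply is_linear_scal_l|].
  intros x' Hx'.
  apply (is_filter_lim_locally_unique (V := AbsRing_NormedModule K)) in Hx'.
  subst x'. intros [eps Heps].
  pose proof (Rabs_pos M) as HM. pose proof (Rle_abs M) as HMle.
  assert (Hr : (0 < Rmin d (eps / (Rabs M + 1)))%R)
    by (apply Rmin_pos; [exact Hd|apply Rdiv_lt_0_compat; lra]).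
  exists (mkposreal _ Hr). intros y Hy.
  change (abs (minus y x) < Rmin d (eps / (Rabs M + 1)))%R in Hy.
  pose proof (Rmin_l d (eps / (Rabs M + 1))) as Hmin_d.
  pose proof (Rmin_r d (eps / (Rabs M + 1))) as Hmin_eps.
  eapply Rle_trans; [apply Hf; lra|].
  change (norm (minus y x)) with (abs (minus y x)).
  set (r := abs (minus y x)) in *.
  assert (Hr_ge_0 : (0 <= r)%R) by apply abs_ge_0.
  assert (Hsmall : (r * (Rabs M + 1) <= eps)%R).
  { replace eps with (eps / (Rabs M + 1) * (Rabs M + 1))%R by (field; lra).
    apply Rmult_le_compat_r; lra. }
  simpl. nra.
Qed.

Lemma is_derive_linear_comp {K : AbsRing} {U V : NormedModule K} (f : K -> U) (L : U -> V)
  (x : K) (l : U) :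
  is_linear L -> is_derive f x l -> is_derive (fun y => L (f y)) x (L l).
Proof.
  intros HL Hf. apply (filterdiff_ext_lin _ (fun y : K => L (scal y l))).
  - exact (filterdiff_comp' f L x _ L Hf (filterdiff_linear L HL)).
  - intro y. now apply linear_scal.
Qed.

Lemma is_derive_C_components (g : R -> C) (t : R) (l : C) :
  is_derive (fun t => Re (g t)) t (Re l) -> is_derive (fun t => Im (g t)) t (Im l) ->
  is_derive (V := C_R_NormedModule) g t l.
Proof.
  intros Hre Him.
  set (one := RtoC 1 : C_R_NormedModule). set (i := Ci : C_R_NormedModule).
  assert (Hsplit : forall z : C, plus (scal (Re z) one) (scal (Im z) i) = z).
  { intros [x y]. unfold one, i. rewrite !scal_R_Cmult.
    unfold plus; cbn. unfold prod_plus, plus; cbn. f_equal; ring. }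
  rewrite <- (Hsplit l).
  apply (is_derive_ext (fun t => plus (scal (Re (g t)) one) (scal (Im (g t)) i)));
    [intro; apply Hsplit|].
  apply (is_derive_plus (V := C_R_NormedModule));
    now apply (is_derive_scal_l (V := C_R_NormedModule)).
Qed.

Lemma re_minus (z w : C) : Re (z - w) = (Re z - Re w)%R.
Proof. reflexivity. Qed.

Lemma im_minus (z w : C) : Im (z - w) = (Im z - Im w)%R.
Proof. reflexivity. Qed.

(* The mean value theorem for the component of [g] along [g b - g a]. *)
Lemma Cmod_mean_value_le (g g' : R -> C) (a b M : R) : (a <= b)%R ->
  (forall t, (a <= t <= b)%R -> is_derive (V := C_R_NormedModule) g t (g' t)) ->
  (forall t, (a <= t <= b)%R -> (Cmod (g' t) <= M)%R) ->
  (Cmod (g b - g a) <= M * (b - a))%R.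
Proof.
  intros Hab Hg HM. set (w := g b - g a).
  set (along := fun z => (Re w * Re z + Im w * Im z)%R).
  assert (Halong : forall z, (along z <= Cmod w * Cmod z)%R).
  { intro z. rewrite <- (Cmod_conj w), <- Cmod_mult.
    eapply Rle_trans; [|apply re_le_Cmod]. eapply Rle_trans; [|apply Rle_abs].
    rewrite re_mult, re_conj, im_conj. unfold along. lra. }
  assert (Hd : forall t, (a <= t <= b)%R ->
    is_derive (fun t => along (g t)) t (along (g' t))).
  { intros t Ht. apply (is_derive_plus (V := R_NormedModule)); apply is_derive_scal.
    - exact (is_derive_linear_comp g fst t _ is_linear_fst (Hg t Ht)).
    - exact (is_derive_linear_comp g snd t _ is_linear_snd (Hg t Ht)). }
  destruct (MVT_gen (fun t => along (g t)) a b (fun t => along (g' t)))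
    as [t [Ht Hincr]]; rewrite ?Rmin_left, ?Rmax_right in * by exact Hab.
  { intros t Ht. apply Hd; lra. }
  { intros t Ht. apply continuity_pt_filterlim, (ex_derive_continuous (V := R_NormedModule)).
    eexists; now apply Hd. }
  assert (Hw : (Cmod w ^ 2 = along (g b) - along (g a))%R).
  { rewrite Cmod2_alt. unfold along, w. rewrite re_minus, im_minus. ring. }
  pose proof (Cmod_ge_0 w) as Hw_ge_0.
  destruct (Rle_lt_or_eq_dec _ _ Hw_ge_0) as [Hpos| <-].
  - apply (Rmult_le_reg_l (Cmod w)); [exact Hpos|].
    replace (Cmod w * Cmod w)%R with (Cmod w ^ 2)%R by ring.
    rewrite Hw, Hincr, <- Rmult_assoc. apply Rmult_le_compat_r; [lra|].
    eapply Rle_trans; [apply Halong|]. apply Rmult_le_compat_l; [lra|now apply HM].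
  - specialize (HM t Ht). pose proof (Cmod_ge_0 (g' t)). nra.
Qed.

Lemma exp_le (x y : R) : (x <= y)%R -> (exp x <= exp y)%R.
Proof. intros [Hxy| ->]; [left; now apply exp_increasing|apply Rle_refl]. Qed.

Lemma Cexp_0 : Cexp 0 = 1.
Proof. unfold Cexp; cbn. rewrite exp_0, cos_0, sin_0. unfold RtoC. f_equal; ring. Qed.

Lemma Cexp_plus (z w : C) : Cexp (z + w) = Cexp z * Cexp w.
Proof.
  destruct z as [x y], w as [u v]. unfold Cexp, Cplus, Cmult; cbn.
  rewrite exp_plus, cos_plus, sin_plus. f_equal; ring.
Qed.

Lemma Cmod_Cexp (z : C) : Cmod (Cexp z) = exp (Re z).
Proof.
  unfold Cmod, Cexp; cbn [fst snd].
  replace ((exp (Re z) * cos (Im z)) ^ 2 + (exp (Re z) * sin (Im z)) ^ 2)%R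
    with (exp (Re z) * exp (Re z) * ((sin (Im z))² + (cos (Im z))²))%R
    by (unfold Rsqr; ring).
  rewrite sin2_cos2, Rmult_1_r. apply sqrt_square, Rlt_le, exp_pos.
Qed.

Lemma Cmod_Cexp_le (z : C) : (Cmod (Cexp z) <= exp (Cmod z))%R.
Proof.
  rewrite Cmod_Cexp. apply exp_le. eapply Rle_trans; [apply Rle_abs|apply re_le_Cmod].
Qed.

Lemma Cmod_scaled_le (t : R) (z : C) : (0 <= t <= 1)%R -> (Cmod (t * z) <= Cmod z)%R.
Proof.
  intro Ht. rewrite Cmod_mult, Cmod_R, Rabs_pos_eq by lra.
  pose proof (Cmod_ge_0 z). nra.
Qed.

Lemma is_derive_Cexp_scaled (z : C) (t : R) :
  is_derive (V := C_R_NormedModule) (fun t : R => Cexp (t * z)) t (z * Cexp (t * z)).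
Proof.
  apply is_derive_C_components; rewrite ?re_mult, ?im_mult;
    unfold Cexp; rewrite re_scal_l, im_scal_l; cbn [Re Im fst snd].
  - apply (is_derive_ext (fun t => exp (t * Re z) * cos (t * Im z))%R).
    + intro u. now rewrite re_scal_l, im_scal_l.
    + auto_derive; [trivial|ring].
  - apply (is_derive_ext (fun t => exp (t * Re z) * sin (t * Im z))%R).
    + intro u. now rewrite re_scal_l, im_scal_l.
    + auto_derive; [trivial|ring].
Qed.

Lemma Cmod_Cexp_sub_1_le (z : C) : (Cmod (Cexp z - 1) <= Cmod z * exp (Cmod z))%R.
Proof.
  pose proof (Cmod_mean_value_le (fun t => Cexp (t * z)) (fun t => z * Cexp (t * z))
    0 1 (Cmod z * exp (Cmod z))) as Hmean.
  cbv beta in Hmean. rewrite Cmult_1_l, Cmult_0_l, Cexp_0, Rminus_0_r, Rmult_1_r in Hmean.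
  apply Hmean; [lra| |].
  - intros t _. apply is_derive_Cexp_scaled.
  - intros t Ht. rewrite Cmod_mult. apply Rmult_le_compat_l; [apply Cmod_ge_0|].
    eapply Rle_trans; [apply Cmod_Cexp_le|]. now apply exp_le, Cmod_scaled_le.
Qed.

Lemma Cmod_Cexp_sub_1_sub_le (z : C) :
  (Cmod (Cexp z - 1 - z) <= Cmod z ^ 2 * exp (Cmod z))%R.
Proof.
  pose proof (Cmod_mean_value_le (fun t => Cexp (t * z) - t * z)
    (fun t => z * (Cexp (t * z) - 1)) 0 1 (Cmod z ^ 2 * exp (Cmod z))) as Hmean.
  cbv beta in Hmean. rewrite Cmult_1_l, Cmult_0_l, Cexp_0, Rminus_0_r, Rmult_1_r in Hmean.
  replace (Cexp z - 1 - z) with (Cexp z - z - (1 - 0)) by ring.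
  apply Hmean; [lra| |].
  - intros t _. replace (z * (Cexp (t * z) - 1)) with (z * Cexp (t * z) - 1 * z) by ring.
    apply (is_derive_minus (V := C_R_NormedModule)); [apply is_derive_Cexp_scaled|].
    apply (is_derive_ext (V := C_R_NormedModule) (fun u => scal u (z : C_R_NormedModule)));
      [intro u; apply scal_R_Cmult|].
    rewrite <- scal_R_Cmult. apply (is_derive_scal_l (V := C_R_NormedModule)).
    exact (is_derive_id t).
  - intros t Ht. rewrite Cmod_mult. cbn [pow]. rewrite Rmult_1_r, Rmult_assoc.
    apply Rmult_le_compat_l; [apply Cmod_ge_0|].
    eapply Rle_trans; [apply Cmod_Cexp_sub_1_le|].
    apply Rmult_le_compat; [apply Cmod_ge_0|apply Rlt_le, exp_pos| |].
    + now apply Cmod_scaled_le.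
    + now apply exp_le, Cmod_scaled_le.
Qed.

Lemma Cmod_nat_cpow (n : nat) (z : C) : Cmod (nat_cpow n z) = Rpower (INR n) (Re z).
Proof. unfold nat_cpow. now rewrite Cmod_Cexp, re_scal_r. Qed.

Lemma nat_cpow_plus (n : nat) (z w : C) :
  nat_cpow n (z + w) = nat_cpow n z * nat_cpow n w.
Proof. unfold nat_cpow. now rewrite Cmult_plus_distr_r, Cexp_plus. Qed.

Lemma ln_INR_mult (m n : nat) : (1 <= m)%nat -> (1 <= n)%nat ->
  ln (INR (m * n)) = (ln (INR m) + ln (INR n))%R.
Proof. intros Hm Hn. rewrite mult_INR. apply ln_mult; apply lt_0_INR; lia. Qed.

Lemma nat_cpow_mult (m n : nat) (z : C) : (1 <= m)%nat -> (1 <= n)%nat ->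
  nat_cpow (m * n) z = nat_cpow m z * nat_cpow n z.
Proof.
  intros Hm Hn. unfold nat_cpow.
  now rewrite ln_INR_mult, RtoC_plus, Cmult_plus_distr_l, Cexp_plus.
Qed.

Lemma nat_cpow_1 (n : nat) : (1 <= n)%nat -> nat_cpow n 1 = RtoC (INR n).
Proof.
  intro Hn. unfold nat_cpow. rewrite Cmult_1_l. unfold Cexp; cbn.
  rewrite exp_ln by (apply lt_0_INR; lia). rewrite cos_0, sin_0.
  unfold RtoC. f_equal; ring.
Qed.

Lemma ln_INR_ge_0 (n : nat) : (1 <= n)%nat -> (0 <= ln (INR n))%R.
Proof. intro Hn. rewrite <- ln_1. apply ln_le; [lra|]. now apply (le_INR 1). Qed.

Lemma ln_le_Rpower (d x : R) : (0 < d)%R -> (ln x <= / d * Rpower x d)%R.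
Proof.
  intro Hd. apply (Rmult_le_reg_l d); [exact Hd|].
  rewrite <- Rmult_assoc, Rinv_r, Rmult_1_l by lra.
  pose proof (exp_ineq1_le (d * ln x)). unfold Rpower. lra.
Qed.

Lemma Cmod_nat_cpow_sub_1_sub_le (n : nat) (z : C) : (1 <= n)%nat ->
  (Cmod (nat_cpow n z - 1 - z * ln (INR n))
   <= Cmod z ^ 2 * (ln (INR n) ^ 2 * Rpower (INR n) (Cmod z)))%R.
Proof.
  intro Hn. eapply Rle_trans; [apply Cmod_Cexp_sub_1_sub_le|].
  rewrite Cmod_mult, Cmod_R, (Rabs_pos_eq _ (ln_INR_ge_0 n Hn)).
  unfold Rpower. right; ring.
Qed.

(** * Dirichlet series *)

Lemma Cmod_dirichlet_term (a : nat -> C) (s : C) (n : nat) :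
  Cmod (dirichlet_term a s n) = (Cmod (a (S n)) * Rpower (INR (S n)) (- Re s))%R.
Proof. unfold dirichlet_term. now rewrite Cmod_mult, Cmod_nat_cpow, re_opp. Qed.

Lemma dirichlet_abs_cv_dominated (a b : nat -> C) (s t : C) (M : R) :
  (forall n, (1 <= n)%nat ->
    (Cmod (b n) <= M * (Cmod (a n) * Rpower (INR n) (Re s - Re t)))%R) ->
  dirichlet_abs_cv a t -> dirichlet_abs_cv b s.
Proof.
  intros Hab Ha.
  apply (ex_series_le (V := R_CompleteNormedModule) _
    (fun n => M * Cmod (dirichlet_term a t n))%R).
  - intro n. change (Rabs (Cmod (dirichlet_term b s n))
      <= M * Cmod (dirichlet_term a t n))%R.
    rewrite Rabs_pos_eq, !Cmod_dirichlet_term by apply Cmod_ge_0.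
    replace (- Re t)%R with (Re s - Re t + - Re s)%R by ring.
    rewrite Rpower_plus, <- !Rmult_assoc.
    apply Rmult_le_compat_r; [apply Rlt_le, exp_pos|].
    rewrite Rmult_assoc. apply Hab; lia.
  - apply (ex_series_scal_l (V := R_NormedModule) M). exact Ha.
Qed.

Lemma dirichlet_abs_cv_Re_le (a : nat -> C) (s t : C) : (Re t <= Re s)%R ->
  dirichlet_abs_cv a t -> dirichlet_abs_cv a s.
Proof.
  intro Hts. apply (dirichlet_abs_cv_dominated _ _ _ _ 1). intros n Hn.
  rewrite Rmult_1_l. rewrite <- (Rmult_1_r (Cmod (a n))) at 1.
  apply Rmult_le_compat_l; [apply Cmod_ge_0|].
  rewrite <- (Rpower_O (INR n)) by (apply lt_0_INR; lia).
  apply Rle_Rpower; [now apply (le_INR 1)|lra].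
Qed.

Lemma dirichlet_correct (a : nat -> C) (s : C) : dirichlet_abs_cv a s ->
  is_series (V := C_NormedModule) (dirichlet_term a s) (dirichlet a s).
Proof. apply CSeries_abs_correct. Qed.

Definition mul_log (a : nat -> C) (n : nat) : C := a n * RtoC (ln (INR n)).

Lemma dirichlet_abs_cv_mul_log (a : nat -> C) (s t : C) : (Re t < Re s)%R ->
  dirichlet_abs_cv a t -> dirichlet_abs_cv (mul_log a) s.
Proof.
  intro Hts. apply (dirichlet_abs_cv_dominated _ _ _ _ (/ (Re s - Re t))).
  intros n Hn. unfold mul_log.
  rewrite Cmod_mult, Cmod_R, (Rabs_pos_eq _ (ln_INR_ge_0 n Hn)).
  rewrite (Rmult_comm (/ _)), Rmult_assoc, (Rmult_comm _ (/ _)).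
  apply Rmult_le_compat_l; [apply Cmod_ge_0|]. apply ln_le_Rpower; lra.
Qed.

Lemma Cmod_dirichlet_term_remainder_le (a : nat -> C) (s w : C) (d : R) (n : nat) :
  (Cmod (w - s) <= d)%R ->
  (Cmod (dirichlet_term a w n - dirichlet_term a s n
      - (w - s) * - dirichlet_term (mul_log a) s n)
   <= Cmod (w - s) ^ 2 * Cmod (dirichlet_term (mul_log (mul_log a)) (s - d) n))%R.
Proof.
  intro Hw. set (k := S n). assert (Hk : (1 <= k)%nat) by (unfold k; lia).
  set (h := w - s) in *.
  replace (dirichlet_term a w n - dirichlet_term a s n
      - h * - dirichlet_term (mul_log a) s n)
    with (dirichlet_term a s n * (nat_cpow k (- h) - 1 - - h * ln (INR k))).
  - rewrite Cmod_mult, !Cmod_dirichlet_term. fold k. unfold mul_log.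
    rewrite !Cmod_mult, Cmod_R, (Rabs_pos_eq _ (ln_INR_ge_0 k Hk)).
    replace (- Re (s - d))%R with (- Re s + d)%R
      by (rewrite re_minus, re_RtoC; ring).
    rewrite Rpower_plus.
    set (term := (Cmod (a k) * Rpower (INR k) (- Re s))%R).
    transitivity (term * (Cmod h ^ 2 * (ln (INR k) ^ 2 * Rpower (INR k) d)))%R;
      [|unfold term; right; ring].
    apply Rmult_le_compat_l;
      [apply Rmult_le_pos; [apply Cmod_ge_0|apply Rlt_le, exp_pos]|].
    eapply Rle_trans; [exact (Cmod_nat_cpow_sub_1_sub_le k (- h) Hk)|].
    rewrite Cmod_opp. do 2 (apply Rmult_le_compat_l; [apply pow2_ge_0|]).
    apply Rle_Rpower; [now apply (le_INR 1)|exact Hw].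
  - unfold dirichlet_term, mul_log. fold k.
    replace (- w) with (- s + - h) by (unfold h; ring).
    rewrite nat_cpow_plus. ring.
Qed.

Lemma Cmod_dirichlet_remainder_le (a : nat -> C) (s w : C) (d : R) :
  (Cmod (w - s) <= d)%R ->
  dirichlet_abs_cv a w -> dirichlet_abs_cv a s -> dirichlet_abs_cv (mul_log a) s ->
  dirichlet_abs_cv (mul_log (mul_log a)) (s - d) ->
  (Cmod (dirichlet a w - dirichlet a s - (w - s) * - dirichlet (mul_log a) s)
   <= Cmod (w - s) ^ 2
      * Series (fun n => Cmod (dirichlet_term (mul_log (mul_log a)) (s - d) n)))%R.
Proof.
  intros Hws Hw Hs Hlog Hlog2.
  apply (norm_is_series_le (V := C_NormedModule)
    (fun n => dirichlet_term a w n - dirichlet_term a s n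
      - (w - s) * - dirichlet_term (mul_log a) s n) _
    (fun n => Cmod (w - s) ^ 2 * Cmod (dirichlet_term (mul_log (mul_log a)) (s - d) n))%R).
  - apply (is_series_minus (V := C_NormedModule)
      (fun n => dirichlet_term a w n - dirichlet_term a s n)
      (fun n => (w - s) * - dirichlet_term (mul_log a) s n)).
    + apply (is_series_minus (V := C_NormedModule)); now apply dirichlet_correct.
    + apply (is_series_scal (V := C_NormedModule) (w - s)
        (fun n => - dirichlet_term (mul_log a) s n)).
      apply (is_series_opp (V := C_NormedModule) (dirichlet_term (mul_log a) s)).
      now apply dirichlet_correct.
  - intro n. now apply Cmod_dirichlet_term_remainder_le.
  - apply (is_series_scal (V := R_NormedModule)), Series_correct, Hlog2.
Qed.

Lemma is_derive_dirichlet (a : nat -> C) (s t : C) : (Re t < Re s)%R ->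
  dirichlet_abs_cv a t ->
  is_derive (V := C_NormedModule) (dirichlet a) s (- dirichlet (mul_log a) s).
Proof.
  intros Hts Ha. set (d := ((Re s - Re t) / 3)%R).
  assert (Hd : (0 < d)%R) by (unfold d; lra).
  apply (is_derive_of_quadratic_remainder (V := C_NormedModule) _ _ _ d
    (Series (fun n => Cmod (dirichlet_term (mul_log (mul_log a)) (s - d) n))) Hd).
  intros w Hw. change (Cmod (w - s) <= d)%R in Hw.
  apply Cmod_dirichlet_remainder_le; [exact Hw| | | |].
  - apply dirichlet_abs_cv_Re_le with (2 := Ha).
    pose proof (re_le_Cmod (w - s)) as Hre. apply Rabs_le_between in Hre.
    rewrite re_minus in Hre. unfold d in *. lra.
  - apply dirichlet_abs_cv_Re_le with (2 := Ha). lra.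
  - now apply dirichlet_abs_cv_mul_log with t.
  - apply dirichlet_abs_cv_mul_log with (s - (2 * d)%R);
      [rewrite !re_minus, !re_RtoC; lra|].
    apply dirichlet_abs_cv_mul_log with t; [|exact Ha].
    rewrite re_minus, re_RtoC. unfold d. lra.
Qed.

Lemma dirichlet_conv_mul (m a b : nat -> C) (n : nat) :
  (forall i j, (1 <= i)%nat -> (1 <= j)%nat -> m (i * j)%nat = m i * m j) ->
  (1 <= n)%nat ->
  dirichlet_conv (V := C_NormedModule) (fun k => a k * m k) (fun k => b k * m k) n
  = dirichlet_conv (V := C_NormedModule) a b n * m n.
Proof.
  intros Hm Hn. unfold dirichlet_conv.
  etransitivity; [|exact (sum_divisors_mult_r (K := C_Ring) (m n) _ n)].
  apply sum_divisors_ext. intros d Hd Hdn.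
  replace (m n) with (m d * m (n / d)%nat) by (rewrite <- Hm, <- Hdn by nia; reflexivity).
  change (a d * m d * (b (n / d)%nat * m (n / d)%nat)
    = a d * b (n / d)%nat * (m d * m (n / d)%nat)). ring.
Qed.

Lemma is_series_dirichlet_term_conv (a b : nat -> C) (s : C) :
  dirichlet_abs_cv a s -> dirichlet_abs_cv b s ->
  is_series (V := C_NormedModule)
    (dirichlet_term (dirichlet_conv (V := C_NormedModule) a b) s)
    (dirichlet a s * dirichlet b s).
Proof.
  intros Ha Hb.
  eapply is_series_ext.
  { intro n. apply (dirichlet_conv_mul (fun k => nat_cpow k (- s)) a b); [|lia].
    intros i j. apply nat_cpow_mult. }
  apply (is_series_dirichlet_conv (V := C_NormedModule)).
  - apply is_series_AbsRing_C. exact (dirichlet_correct a s Ha).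
  - exact Ha.
  - exact (dirichlet_correct b s Hb).
Qed.

Lemma dirichlet_term_mul_id (a : nat -> C) (s : C) (n : nat) :
  dirichlet_term (fun k => a k * RtoC (INR k)) s n = dirichlet_term a (s - 1) n.
Proof.
  unfold dirichlet_term.
  replace (- (s - 1)) with (1 + - s) by ring.
  rewrite nat_cpow_plus, nat_cpow_1 by lia. ring.
Qed.

Lemma dirichlet_mul_id (a : nat -> C) (s : C) :
  dirichlet (fun k => a k * RtoC (INR k)) s = dirichlet a (s - 1).
Proof.
  unfold dirichlet, CSeries.
  f_equal; apply Series_ext; intro n; now rewrite dirichlet_term_mul_id.
Qed.

Lemma dirichlet_abs_cv_mul_id (a : nat -> C) (s : C) :
  dirichlet_abs_cv a (s - 1) -> dirichlet_abs_cv (fun k => a k * RtoC (INR k)) s.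
Proof.
  apply ex_series_ext. intro n. now rewrite dirichlet_term_mul_id.
Qed.

Lemma log_sum_bounds (k : nat) : (0 <= log_sum k <= INR k * ln (INR k))%R.
Proof.
  unfold log_sum. induction k as [|k IH].
  - rewrite sum_n_m_zero by lia. cbn. change (0 <= 0 <= 0 * ln 0)%R. lra.
  - rewrite sum_n_Sm by lia. change (@plus R_AbelianMonoid) with Rplus.
    pose proof (ln_INR_ge_0 (S k) ltac:(lia)) as Hln.
    assert (Hmono : (INR k * ln (INR k) <= INR k * ln (INR (S k)))%R).
    { destruct k as [|k]; [simpl; lra|].
      apply Rmult_le_compat_l; [apply pos_INR|].
      apply ln_le; [apply lt_0_INR; lia|apply le_INR; lia]. }
    replace (INR (S k) * ln (INR (S k)))%R
      with (INR k * ln (INR (S k)) + ln (INR (S k)))%R by (rewrite (S_INR k); ring).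
    lra.
Qed.

Lemma dirichlet_abs_cv_mul_log_sum (a : nat -> C) (s t : C) : (Re t + 1 < Re s)%R ->
  dirichlet_abs_cv a t -> dirichlet_abs_cv (fun k => a k * RtoC (log_sum k)) s.
Proof.
  intros Hts Ha.
  apply (dirichlet_abs_cv_dominated (mul_log a) _ s (s - 1) 1);
    [|apply dirichlet_abs_cv_mul_log with t;
      [rewrite re_minus, re_RtoC; lra|exact Ha]].
  intros n Hn. destruct (log_sum_bounds n) as [Hge Hle]. unfold mul_log.
  rewrite re_minus, re_RtoC, !Cmod_mult, !Cmod_R, !Rabs_pos_eq
    by (exact Hge || now apply ln_INR_ge_0).
  replace (Re s - (Re s - 1))%R with 1%R by ring.
  rewrite Rpower_1, Rmult_1_l, Rmult_assoc by (apply lt_0_INR; lia).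
  apply Rmult_le_compat_l; [apply Cmod_ge_0|]. lra.
Qed.

Lemma sum_ln_multiples (d q : nat) : (1 <= d)%nat ->
  sum_n_m (fun m => ln (INR (d * m))) 1 q = (INR q * ln (INR d) + log_sum q)%R.
Proof.
  intro Hd. rewrite (sum_n_m_ext_loc _ (fun m => plus (ln (INR d)) (ln (INR m)))).
  - rewrite sum_n_m_plus, sum_n_m_const. now replace (S q - 1)%nat with q by lia.
  - intros m Hm. apply ln_INR_mult; lia.
Qed.

Lemma u_sum_dirichlet_conv (f g : nat -> C) (k : nat) :
  u_sum f g k
  = dirichlet_conv (V := C_NormedModule) (mul_log f) (fun m => g m * RtoC (INR m)) k
    + dirichlet_conv (V := C_NormedModule) f (fun m => g m * RtoC (log_sum m)) k.
Proof.
  transitivity (sum_n_m (G := C_AbelianMonoid) (fun j => sum_divisors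
    (fun d => f d * g (k / d)%nat * RtoC (ln (INR j))) (Nat.gcd k j)) 1 k).
  { apply sum_n_m_ext; intro j. symmetry. exact (sum_divisors_mult_r (K := C_Ring) _ _ _). }
  rewrite (sum_n_m_sum_divisors_gcd
    (fun d j => f d * g (k / d)%nat * RtoC (ln (INR j)))).
  etransitivity; [|exact (sum_divisors_plus (G := C_AbelianMonoid) _ _ k)].
  apply sum_divisors_ext. intros d Hd _.
  etransitivity; [exact (sum_n_m_mult_l (K := C_Ring) (f d * g (k / d)%nat) _ 1 _)|].
  rewrite <- RtoC_sum_n_m, sum_ln_multiples, RtoC_plus, RtoC_mult by exact Hd.
  unfold mul_log. set (q := (k / d)%nat).
  change (f d * g q * (RtoC (INR q) * RtoC (ln (INR d)) + RtoC (log_sum q))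
    = f d * RtoC (ln (INR d)) * (g q * RtoC (INR q)) + f d * (g q * RtoC (log_sum q))).
  ring.
Qed.

Lemma is_series_dirichlet_term_u_sum (f g : nat -> C) (s : C) :
  dirichlet_abs_cv f s -> dirichlet_abs_cv (mul_log f) s -> dirichlet_abs_cv g (s - 1) ->
  dirichlet_abs_cv (fun k => g k * RtoC (log_sum k)) s ->
  is_series (V := C_NormedModule) (dirichlet_term (u_sum f g) s)
    (dirichlet (mul_log f) s * dirichlet g (s - 1)
     + dirichlet f s * dirichlet (fun k => g k * RtoC (log_sum k)) s).
Proof.
  intros Hf Hflog Hg HgL. rewrite <- dirichlet_mul_id.
  eapply is_series_ext;
    [|apply (is_series_plus (V := C_NormedModule)); apply is_series_dirichlet_term_conv].
  - intro n. unfold dirichlet_term. rewrite u_sum_dirichlet_conv.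
    symmetry. exact (Cmult_plus_distr_r _ _ _).
  - exact Hflog.
  - now apply dirichlet_abs_cv_mul_id.
  - exact Hf.
  - exact HgL.
Qed.

Theorem theorem6 (f g : nat -> C) (sigma1 sigma2 alpha : R)
  (hF : forall s : C, (sigma1 < Re s)%R -> dirichlet_abs_cv f s)
  (hG : forall s : C, (sigma2 < Re s)%R -> dirichlet_abs_cv g s)
  (hU : forall s : C, (alpha < Re s)%R -> dirichlet_abs_cv (u_sum f g) s) :
  let gL := fun k : nat => g k * RtoC (log_sum k) in
  (forall s : C, (sigma2 + 1 < Re s)%R -> dirichlet_abs_cv gL s) /\
  (forall s : C, (Rmax alpha (Rmax sigma1 (sigma2 + 1)) < Re s)%R ->
     @ex_derive C_AbsRing C_NormedModule (dirichlet f) s /\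
     dirichlet (u_sum f g) s =
       - C_derive (dirichlet f) s * dirichlet g (s - 1)
       + dirichlet f s * dirichlet gL s).
Proof.
  intro gL.
  assert (HgL : forall s : C, (sigma2 + 1 < Re s)%R -> dirichlet_abs_cv gL s).
  { intros s Hs. set (t := RtoC ((sigma2 + (Re s - 1)) / 2)).
    apply (dirichlet_abs_cv_mul_log_sum g s t); [|apply hG]; cbn; lra. }
  split; [exact HgL|]. intros s Hs.
  apply Rmax_Rlt in Hs as [_ Hs]. apply Rmax_Rlt in Hs as [Hs1 Hs2].
  set (t := RtoC ((sigma1 + Re s) / 2)).
  assert (Ht : (sigma1 < Re t < Re s)%R) by (cbn; lra).
  assert (HF' := is_derive_dirichlet f s t (proj2 Ht) (hF t (proj1 Ht))).
  split; [eexists; exact HF'|].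
  rewrite (is_C_derive_unique _ _ _ HF').
  replace (- - _) with (dirichlet (mul_log f) s) by ring.
  apply CSeries_correct, is_series_dirichlet_term_u_sum.
  - now apply hF.
  - apply dirichlet_abs_cv_mul_log with t; [|apply hF]; apply Ht.
  - apply hG. rewrite re_minus, re_RtoC. lra.
  - now apply HgL.
Qed.
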